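(* Let $0<\gamma<\rho<1$ and $\theta=\frac{1-\gamma}{1-\rho}>1$. Consider a Markov decision process $(S,A,\mathbb K,q,u,\beta)$ with $r=(1-\beta)u^{1-\rho}$ as described in the context. Let $\omega:S\to[1,\infty)$ be continuous and let $M>0$, $c\ge 1$ be constants such that: (i) for each $s\in S$ the set $A(s)$ is compact, and the correspondence $s\mapsto A(s)$ is upper semicontinuous; (ii) $r(s,a)\le M\omega(s)$ for all $(s,a)\in\mathbb K$; (iii) the function $(s,a)\mapsto\int_S\omega(s')^\theta q(ds'|s,a)$ is continuous on $\mathbb K$, $\int_S\omega(s')^\theta q(ds'|s,a)\le c\,\omega(s)^\theta$ for all $(s,a)\in\mathbb K$, and $c^{1/\theta}\beta<1$. For $V\in\mathcal U_+^\omega$ define $$F_2V(s)=\max_{a\in A(s)}\left[r(s,a)+\beta\left(\int_S V(s')^\theta q(ds'|s,a)\right)^{1/\theta}\right],\quad s\in S.$$ Then: (a) $F_2$ maps $\mathcal U_+^\omega$ into $\mathcal U_+^\omega$ and is a $c^{1/\theta}\beta$-contraction with respect to $\|\cdot\|_\omega$. It has a unique fixed point $w_*\in\mathcal U_+^\omega$. Moreover, for the $n$-th composition $F_2^n$ of $F_2$ with itself and the zero function $\hat 0$, $$\|F_2^n\hat 0-w_*\|_\omega\le\frac{c^{n/\theta}\beta^{n}}{1-c^{1/\theta}\beta}M,\qquad n\in\mathbb N.$$ (b) The Bellman equation $$v(s)=\max_{a\in A(s)}H(s,a,v),\quad s\in S,$$ has a unique solution in the class of functions $v:S\to[0,\infty)$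 with $v^{1-\rho}\in\mathcal U_+^\omega$, namely $v_*=w_*^{1/(1-\rho)}$. (c) There exists $f_*\in\Phi$ such that $v_*(s)=H(s,f_*(s),v_* )$ for all $s\in S$. (d) The stationary policy $f_*$ is optimal.
   Context: Model. $S$ (states) and $A$ (actions) are Borel spaces, i.e. Borel subsets of complete separable metric spaces. $\mathbb K\subset S\times A$ is a non-empty Borel set whose sections $A(s)=\{a\in A:(s,a)\in\mathbb K\}$ are non-empty for each $s\in S$. $q$ is a transition probability from $\mathbb K$ to $S$ which is Feller: $(s,a)\mapsto\int_S v(s')q(ds'|s,a)$ is continuous on $\mathbb K$ for every bounded continuous $v:S\to\mathbb R$. $u:\mathbb K\to\mathbb R$ is a non-negative upper semicontinuous per-period utility, $\beta\in[0,1)$ is the discount factor, and $r(s,a)=(1-\beta)u(s,a)^{1-\rho}$. Aggregator. $H(s,a,w)=\left[r(s,a)+\beta\left(\int_S w(s')^{1-\gamma}q(ds'|s,a)\right)^{\frac{1-\rho}{1-\gamma}}\right]^{\frac1{1-\rho}}$ for $(s,a)\in\mathbb K$, whenever the integral exists. Function spaces. For $v:S\to\mathbb R$, $\|v\|_\omega=\sup_{s\in S}|v(s)|/\omega(s)$. $\mathcal U_+^\omega$ is the set of non-negative upper semicontinuous functions on $S$ with finite $\|\cdot\|_\omega$; $\mathcal B_+^\omega$ is the set of non-negative Borel measurable functions on $S$ with finite $\|\cdot\|_\omega$. Contraction. A self-map $F$ of a metric space $(X,d)$ is a $\delta$-contraction if $d(Fx_1,Fx_2)\le\delta d(x_1,x_2)$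 for all $x_1,x_2\in X$. Correspondences. A correspondence $\varphi$ from $S$ to a separable metric space $Z$ is upper semicontinuous if $\{s\in S:\varphi(s)\cap D\ne\emptyset\}$ is closed for every closed $D\subset Z$. Policies. $\Phi$ is the set of Borel measurable maps $f:S\to A$ with $f(s)\in A(s)$ for all $s$; each $f\in\Phi$ is identified with the stationary policy $(f,f,\ldots)$. For $f\in\Phi$, an $f$-value function is a function $v_f:S\to[0,\infty)$ with $v_f^{1-\rho}\in\mathcal B_+^\omega$ and $v_f(s)=H(s,f(s),v_f)$ for all $s\in S$. A policy $f_*\in\Phi$ is optimal if $v_{f_*}(s)=\tilde v(s)\ge v_f(s)$ for all $f\in\Phi$ and $s\in S$ (for the $f_*$-value function $v_{f_*}$ and the $f$-value functions $v_f$), where $\tilde v$ is the solution of the Bellman equation (in the class stated in the claim). *)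

(* Defs.v *)
From mathcomp Require Import all_boot all_order all_algebra.
From mathcomp Require Import all_classical all_reals all_analysis measurable_realfun.

Set Implicit Arguments.
Unset Strict Implicit.
Unset Printing Implicit Defensive.

Import Order.TTheory GRing.Theory Num.Theory.
Import numFieldNormedType.Exports.

Local Open Scope classical_set_scope.
Local Open Scope ring_scope.

(* [T] with its Borel sigma-algebra. Measurable types are pointed, hence the
   choice of [ptopologicalType]; the state and action spaces are non-empty
   anyway, because [K] is. *)
Notation borel T := (g_sigma_algebraType (@open T)).

(* [T], as a topological space, is (homeomorphic to) a Borel subset of a
   complete separable metric space. The metric itself plays no role. *)
Definition borel_space (R : realType) (T : topologicalType) :=
  exists (X : metricType R) (i : T -> X),
    [/\ (forall F : set_system X, ProperFilter F -> cauchy F ->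
           exists x : X, F --> x),
        (exists2 D : set X, countable D & dense D),
        injective i,
        (forall U : set T, open U <-> exists2 V : set X, open V & U = i @^-1` V) &
        <<s @open X >> (range i)].

(* On a subset [D], use [upper_semicontinuous (f : subspace D -> R)]. *)
Definition upper_semicontinuous (R : realType) (T : topologicalType)
    (f : T -> R) :=
  forall x a, f x < a -> \forall y \near x, f y < a.

Definition usc_correspondence (S Z : topologicalType) (phi : S -> set Z) :=
  forall D : set Z, closed D -> closed [set s | phi s `&` D !=set0].

Definition is_max (R : realType) (E : set R) (m : R) := E m /\ ubound E m.

(* Extended-real valued, so that "finite norm" is a genuine condition. *)
Definition wnorm (R : realType) (S : Type) (omega v : S -> R) : \bar R :=
  ereal_sup (range (fun s => (`|v s| / omega s)%:E)).

Definition contraction_on (R : realType) (X : Type) (U : set X)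
    (d : X -> X -> \bar R) (delta : R) (F : X -> X) :=
  (forall x, U x -> U (F x)) /\
  (forall x1 x2, U x1 -> U x2 -> (d (F x1) (F x2) <= delta%:E * d x1 x2)%E).

Section spaces.
Context (R : realType) (S : ptopologicalType).

Definition Uplus (omega : S -> R) : set (S -> R) :=
  [set v | [/\ forall s, 0 <= v s, upper_semicontinuous v &
               (wnorm omega v < +oo)%E]].

Definition Bplus (omega : S -> R) : set (S -> R) :=
  [set v | [/\ forall s, 0 <= v s,
               measurable_fun [set: borel S] (v : borel S -> R) &
               (wnorm omega v < +oo)%E]].

End spaces.

(* Functions and kernels on [K] are total on [S * A]; every hypothesis on them
   is restricted to [K] and their values off [K] are never used. *)
Section mdp.
Context (R : realType) (S A : ptopologicalType).
Implicit Types (K : set (S * A)) (q : S * A -> probability (borel S) R).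

Definition actions K (s : S) : set A := [set a | K (s, a)].

Definition transition_probability K q :=
  forall B : set (borel S), measurable B ->
    measurable_fun (K : set (borel (S * A)%type)) (fun k => q k B).

Definition feller K q :=
  forall v : S -> R, continuous v -> (exists C, forall s, `|v s| <= C) ->
    {within K, continuous (fun k => \int[q k]_s v s)}.

Definition reward (beta rho : R) (u : S * A -> R) (k : S * A) : R :=
  (1 - beta) * u k `^ (1 - rho).

(* In [aggregator] and [F2_objective] the integrals are real-valued ([Rintegral]); they
   are used only at functions for which they are finite. *)
Definition aggregator (beta gamma rho : R) (u : S * A -> R) q
    (k : S * A) (w : S -> R) : R :=
  (reward beta rho u k +
   beta * (\int[q k]_s (w s `^ (1 - gamma))) `^ ((1 - rho) / (1 - gamma)))
  `^ (1 - rho)^-1.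

Definition F2_objective (beta rho theta : R) (u : S * A -> R) q
    (V : S -> R) (k : S * A) : R :=
  reward beta rho u k + beta * (\int[q k]_s (V s `^ theta)) `^ theta^-1.

(* A supremum, to be total; attainment has to be proved. *)
Definition F2 (beta rho theta : R) K (u : S * A -> R) q (V : S -> R) (s : S) :=
  sup [set F2_objective beta rho theta u q V (s, a) | a in actions K s].

Definition bellman (beta gamma rho : R) K (u : S * A -> R) q (v : S -> R) :=
  forall s, is_max [set aggregator beta gamma rho u q (s, a) v
                   | a in actions K s] (v s).

Definition policy K (f : S -> A) :=
  measurable_fun [set: borel S] (f : borel S -> borel A) /\
  forall s, actions K s (f s).

Definition value_function (beta gamma rho : R) (omega : S -> R)
    (u : S * A -> R) q (f : S -> A) (v : S -> R) :=
  [/\ forall s, 0 <= v s,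
      Bplus omega (fun s => v s `^ (1 - rho)) &
      forall s, v s = aggregator beta gamma rho u q (s, f s) v].

(* [vt] is the solution of the Bellman equation. It is "the" [f]-value function,
   hence the uniqueness clause. *)
Definition optimal (beta gamma rho : R) (omega : S -> R) K
    (u : S * A -> R) q (vt : S -> R) (f : S -> A) :=
  [/\ policy K f,
      value_function beta gamma rho omega u q f vt,
      forall v, value_function beta gamma rho omega u q f v -> v = vt &
      forall g v, policy K g -> value_function beta gamma rho omega u q g v ->
        forall s, v s <= vt s].

End mdp.

(* Main.v *)
(* The operator F2 is studied through one-sided estimates V1 <= V2 + t omega: by
   Minkowski's inequality and (iii), applying the objective to both sides costs a
   factor delta = c^(1/theta) beta on t. This gives the contraction property, the
   uniqueness statements and, applied along a single policy, the comparison of an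
   f-value function with w_*, without ever maximising over merely Borel functions.
   The fixed point is the supremum of the increasing sequence F2^n 0, which lies
   within delta^n M / (1 - delta) omega of F2^n 0 and is therefore upper
   semicontinuous.

   The objective is upper semicontinuous in (s, a): omega^theta - V^theta, up to a
   constant, is a nonnegative lower semicontinuous function, hence an increasing
   limit of bounded continuous functions, whose integrals are continuous by the
   Feller property. Berge's maximum theorem then preserves upper semicontinuity,
   and the argmax correspondence, which is compact-valued and measurable, has a
   Borel selector. With V = v^(1 - rho), H(s, a, v)^(1 - rho) is the F2-objective
   at V, which carries all results over to the Bellman equation. *)

Require Import Defs.
From mathcomp Require Import all_boot all_order all_algebra.
From mathcomp Require Import all_classical all_reals all_analysis measurable_realfun.
From mathcomp Require Import lra ring.
Import Order.TTheory GRing.Theory Num.Theory.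
Import numFieldNormedType.Exports.
Local Open Scope classical_set_scope.
Local Open Scope ring_scope.

Set Implicit Arguments.
Unset Strict Implicit.
Unset Printing Implicit Defensive.

(** * Upper semicontinuity and compactness *)

Section semicontinuity.
Context {R : realType}.

(** Stated with ambient neighbourhoods rather than the subspace topology, so that neighbourhoods in
    [S * A] split directly into products. *)
Definition usc_on {T : topologicalType} (K : set T) (f : T -> R) :=
  forall x, K x -> forall a, f x < a -> \forall y \near x, K y -> f y < a.

Lemma usc_on_subspace {T : topologicalType} (K : set T) (f : T -> R) :
  upper_semicontinuous (f : subspace K -> R) -> usc_on K f.
Proof.
move=> uf x Kx a fa; have := uf x a fa.
by rewrite /prop_near1 /nbhs /= -(nbhs_subspace_in Kx).
Qed.

Lemma usc_onT {T : topologicalType} (f : T -> R) :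
  upper_semicontinuous f -> usc_on setT f.
Proof. by move=> uf x _ a /uf; apply: filterS => y + _. Qed.

Lemma usc_open {T : topologicalType} (f : T -> R) :
  upper_semicontinuous f <-> forall a, open [set x | f x < a].
Proof.
split=> [uf a|of_ x a fa]; first by rewrite openE => x /uf.
by apply: open_nbhs_nbhs; split; first exact: of_.
Qed.

(** Directedness makes the traces on [B] a base of a proper filter, and a cluster point of it lies
    in every closed [F i]. *)
Lemma compact_nested {T : topologicalType} {I : Type} (D : set I)
    (B : set T) (F : I -> set T) : compact B -> D !=set0 ->
  (forall i, D i -> closed (F i)) -> (forall i, D i -> B `&` F i !=set0) ->
  (forall i j, D i -> D j -> exists2 k, D k & F k `<=` F i `&` F j) ->
  exists2 x, B x & forall i, D i -> F i x.
Proof.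
move=> cB D0 clF BF dirF; pose G := filter_from D (fun i => B `&` F i).
have PG : ProperFilter G.
  apply: filter_from_proper; last by move=> i /BF.
  apply: filter_from_filter => // i j Di Dj.
  have [k Dk kij] := dirF i j Di Dj; exists k => // x [Bx /kij[? ?]].
  by split; split.
have GB : G B by case: D0 => i Di; exists i => // x [].
have [x [Bx clx]] := cB G PG GB; exists x => // i Di.
rewrite (closure_id (F i)).1; last exact: clF.
by move=> U nU; have [|y [[? ?] ?]] := clx (B `&` F i) U _ nU; [exists i|exists y].
Qed.

Lemma usc_on_max {T : topologicalType} (B : set T) (f : T -> R) :
  compact B -> B !=set0 -> usc_on B f -> exists2 x, B x & forall y, B y -> f y <= f x.
Proof.
move=> cB B0 uf.
(* Superlevel sets are only relatively closed in [B], hence the closure; they form a chain because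
   the values of [f] are totally ordered. *)
pose F x := closure (B `&` [set y | f x <= f y]).
have [|||x Bx Fx] := @compact_nested T T B B F cB B0.
- by move=> i _; exact: closed_closure.
- by move=> i Bi; exists i; split=> //; apply: subset_closure; split => /=.
- move=> i j Bi Bj; have [ij|ji] := leP (f i) (f j).
    exists j => //; rewrite subsetI; split; apply: closureS => y [By] /= jy.
      by split=> //=; exact: le_trans jy.
    by split.
  exists i => //; rewrite subsetI; split; apply: closureS => y [By] /= iy.
    by split.
  by split=> //=; exact: le_trans (ltW ji) iy.
exists x => // y By; rewrite leNgt; apply/negP => xy.
have [z [[Bz /= yz] zU]] := Fx y By _ (uf x Bx _ xy).
by have := zU Bz; rewrite ltNge yz.
Qed.

Lemma compact_usc_ge {T : topologicalType} (B : set T) (f : T -> R) (a : R) :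
  compact B -> usc_on B f -> compact (B `&` [set x | a <= f x]).
Proof.
move=> cB uf F PF FB; have [|x [Bx clx]] := cB F PF.
  by apply: filterS FB => x [].
exists x; split=> //; split=> //=; rewrite leNgt; apply/negP => xa.
have [y [[By /= ay] yU]] := clx _ _ FB (uf x Bx _ xa).
by have := yU By; rewrite ltNge ay.
Qed.

(** Tube argument: compactness of [phi s0] yields one neighbourhood [U] of [s0] and an open [W]
    around [phi s0] such that [w < r] on the part of [K] in [U] times [W]; semicontinuity of [phi]
    keeps [phi s] inside [W] for [s] near [s0]. *)
Lemma berge_open {S A : topologicalType} (K : set (S * A)) (phi : S -> set A)
    (w : S * A -> R) (r : R) :
  (forall s, compact (phi s)) -> usc_correspondence phi ->
  (forall s a, phi s a -> K (s, a)) -> usc_on K w ->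
  open [set s | forall a, phi s a -> w (s, a) < r].
Proof.
move=> cphi uphi phiK uw; rewrite openE => s0 /= s0r.
have /compact_near_coveringP cov := cphi s0.
pose P (U : set S) (a' : A) := \forall a \near a', forall s, U s -> K (s, a) -> w (s, a) < r.
have : \forall U \near powerset_filter_from (nbhs s0), phi s0 `<=` P U.
  apply: cov => a pa.
  have [[U W] /= [nU nW] UW] := uw _ (phiK _ _ pa) _ (s0r a pa).
  near=> a' V; rewrite /P.
  have Wa' : nbhs a' W by near: a'; exact: nbhs_interior.
  apply: filterS Wa' => a1 Wa1 s Vs; apply: (UW (s, a1)); split=> //=.
  by apply: (near (small_set_sub nU) V).
move/near_powerset_filter_fromP => [|U nU phiU].
  by move=> V V' VV' PV' a /PV'; rewrite /P; apply: filterS => a' + s /VV'; exact.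
pose W := [set a' | P U a']°.
have /uphi clC : closed (~` W) by apply: open_closedC; exact: open_interior.
have oC := closed_openC clC.
have : nbhs s0 (~` [set s | phi s `&` ~` W !=set0]).
  apply: open_nbhs_nbhs; split=> // -[a [pa]]; apply.
  by apply: nbhs_interior; exact: phiU.
rewrite /=.
apply: filterS2 nU => s Us /= noW a pa.
have Wa : W a by apply: contrapT => nWa; apply: noW; exists a.
by have /nbhs_singleton := interior_subset Wa; apply => //; exact: phiK.
Unshelve. all: by end_near.
Qed.
End semicontinuity.

(** * Borel spaces *)

Section borel_space_metric.
Context {R : realType}.

(** The ambient metric is pulled back along the embedding. A plain function [d] leaves [T] with its
    given topology. *)
Lemma borel_space_metric (T : topologicalType) : borel_space R T ->
  exists d : T -> T -> R, [/\ forall x, d x x = 0, forall x y, 0 <= d x y,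
    forall x y, d x y = d y x, forall x y z, d x z <= d x y + d y z &
    forall x U, nbhs x U <-> exists2 e, 0 < e & [set y | d x y < e] `<=` U].
Proof.
move=> [X [i [_ _ _ openT _]]]; exists (fun x y => mdist (i x) (i y)); split.
- by move=> x; exact: mdistxx.
- by move=> x y; exact: mdist_ge0.
- by move=> x y; exact: metric_sym.
- by move=> x y z; exact: metric_triangle.
move=> x U; split.
  rewrite nbhsE => -[G [/openT [V oV GV] Gx] VU].
  have /nbhs_ballP [e /= e0 eV] : nbhs (i x) V.
    by apply: open_nbhs_nbhs; split=> //; move: Gx; rewrite GV.
  by exists e => // y /= xy; apply: VU; rewrite GV; apply: eV; rewrite ballEmdist.
move=> [e e0 eU]; rewrite nbhsE; exists (i @^-1` (ball (i x) e)°).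
  split; last exact: nbhsx_ballx.
  by apply/openT; exists (ball (i x) e)° => //; exact: open_interior.
by move=> y /= /interior_subset; rewrite ballEmdist => /eU.
Qed.

(** The [C n] come from complements of small balls centred in a countable dense set: a ball around
    [y] of radius below half the distance from [x] to [y] misses [x]. *)
Lemma borel_space_separating (T : topologicalType) : borel_space R T ->
  exists C : nat -> set T, (forall n, closed (C n)) /\
    forall x y, x != y -> exists n, C n x /\ ~ C n y.
Proof.
move=> [X [i [_ [D /countable_injP[g ginj] dD] iinj openT _]]].
(* As [g] is injective on [D], the union has at most one centre, the point of [D] numbered [n]. *)
pose B n m := i @^-1` (\bigcup_(z in [set z | D z /\ g z = n]) ball z m.+1%:R^-1)°.
pose C k := if unpickle k is Some (n, m) then ~` (B n m) else setT.
exists C; split.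
  move=> k; rewrite /C; case: (unpickle k) => [[n m]|]; last exact: closedT.
  apply: open_closedC; apply/openT.
  exists ((\bigcup_(z in [set z | D z /\ g z = n]) ball z m.+1%:R^-1)°) => //.
  exact: open_interior.
move=> x y xy; have d0 : 0 < mdist (i x) (i y).
  by rewrite mdist_gt0; apply: contra_neq xy; exact: iinj.
pose e := mdist (i x) (i y) / 2; have e0 : 0 < e by rewrite divr_gt0.
have [m me] : exists m, m.+1%:R^-1 < e.
  have := near_infty_natSinv_lt (PosNum e0) => -[m _ /(_ m (leqnn m))].
  by exists m.
have m0 : 0 < (m.+1%:R^-1 : R) by rewrite invr_gt0.
have [z [zb Dz]] : ball (i y) m.+1%:R^-1 `&` D !=set0.
  have /dD : (ball (i y) m.+1%:R^-1)° !=set0.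
    by exists (i y); exact: nbhsx_ballx.
  move=> /(_ (open_interior _))[z [/interior_subset ? ?]].
  by exists z.
exists (pickle (g z, m)); rewrite /C pickleK; split.
  move=> /interior_subset[z' [Dz' gz]].
  rewrite (ginj z' z) ?inE//= ballEmdist/= => zx.
  have := metric_triangle (i x) z (i y).
  move: zb; rewrite ballEmdist /= (metric_sym (i y)) (metric_sym (i x) z) => zb.
  rewrite /e in me; move: me zx zb {e0}@e.
  move: (mdist (i x) (i y)) (mdist z (i x)) (mdist z (i y)) (m.+1%:R^-1).
  by move=> a b c r + + + _; lra.
move=> /=; apply; rewrite /B/=.
have zy : mdist z (i y) < m.+1%:R^-1 by move/ball_sym: zb; rewrite ballEmdist.
apply/nbhs_ballP; exists (m.+1%:R^-1 - mdist z (i y)); first by rewrite /= subr_gt0.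
move=> t yt; exists z => //; move: yt; rewrite !ballEmdist /= ltrBrDl.
exact/le_lt_trans/metric_triangle.
Qed.

(* Moreau-Yosida regularisation: [hn n] is the infimal convolution of
   [min (n, h)] with [n d], hence [n]-Lipschitz and bounded. *)
Lemma lsc_approx (T : topologicalType) (h : T -> R) : borel_space R T ->
  (forall x, 0 <= h x) -> (forall x a, a < h x -> \forall y \near x, a < h y) ->
  exists hn : nat -> T -> R, [/\ forall n, continuous (hn n),
    forall n x, 0 <= hn n x <= n%:R,
    forall x, {homo hn ^~ x : m n / (m <= n)%N >-> m <= n},
    forall n x, hn n x <= h x &
    forall x, hn ^~ x @ \oo --> h x].
Proof.
move=> /borel_space_metric [d [dxx d0 dC dD nbhsd]] h0 lh.
pose E n x := range (fun y => Num.min n%:R (h y) + n%:R * d x y).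
pose hn n x := inf (E n x).
have Elb n x : lbound (E n x) 0.
  by move=> _ [y _ <-]; rewrite addr_ge0 ?mulr_ge0// le_min ler0n h0.
have E0 n x : E n x !=set0 by exists (Num.min n%:R (h x) + n%:R * d x x); exists x.
have hnle n x y : hn n x <= Num.min n%:R (h y) + n%:R * d x y.
  by apply: ge_inf; [exists 0; exact: Elb|exists y].
have lehn n x a : (forall y, a <= Num.min n%:R (h y) + n%:R * d x y) -> a <= hn n x.
  by move=> H; apply: lb_le_inf => // _ [y _ <-].
have hn0 n x : 0 <= hn n x by apply: lb_le_inf => //.
have hnmin n x : hn n x <= Num.min n%:R (h x).
  by rewrite (le_trans (hnle n x x))// dxx mulr0 addr0.
have hnh n x : hn n x <= h x.
  by rewrite (le_trans (hnmin n x))// ge_min lexx orbT.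
have lip n x y : hn n x <= hn n y + n%:R * d x y.
  rewrite -lerBlDr; apply: lehn => z; rewrite lerBlDr (le_trans (hnle n x z))//.
  by rewrite -addrA lerD2l -mulrDr ler_wpM2l// addrC dD.
have mono x : {homo hn ^~ x : m n / (m <= n)%N >-> m <= n}.
  move=> m n mn; apply: lehn => y; rewrite (le_trans (hnle m x y))// lerD//.
    by rewrite le_min !ge_min ler_nat mn lexx orbT.
  by rewrite ler_wpM2r ?ler_nat.
exists hn; split => //.
- move=> n x; apply/cvgrPdist_lt => e e0; apply/nbhsd.
  (* The denominator [n.+1] covers the case [n = 0]. *)
  exists (e / n.+1%:R); first by rewrite divr_gt0.
  move=> y /= xy; rewrite (@le_lt_trans _ _ (n%:R * d x y))//.
    have := lip n x y; have := lip n y x; rewrite (dC y) ler_norml.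
    by move: (n%:R * _) => a ? ?; lra.
  rewrite (@le_lt_trans _ _ (n.+1%:R * d x y)) ?ler_wpM2r ?ler_nat//.
  by rewrite mulrC -ltr_pdivlMr.
- by move=> n x; rewrite hn0 (le_trans (hnmin n x))// ge_min lexx.
move=> x; apply/cvgrPdist_le => e e0.
(* If [h x < e], nonnegativity of [hn n x] suffices. Otherwise points [y] closer than [dl] have
   [h y > h x - e], and farther ones pay at least [n * dl >= h x - e]. *)
have [eh|he] := ltP (h x - e) 0.
  near=> n; rewrite ger0_norm ?subr_ge0// lerBlDr -lerBlDl.
  exact: le_trans (ltW eh) (hn0 n x).
have /lh/nbhsd[dl dl0 hdl] : h x - e < h x by rewrite gtrBl.
near=> n.
have n1 : h x - e <= n%:R.
  by near: n; exact: nbhs_infty_ger.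
have n2 : (h x - e) / dl <= n%:R.
  by near: n; exact: nbhs_infty_ger.
rewrite ger0_norm ?subr_ge0// lerBlDr -lerBlDl.
apply: lehn => y; have [/hdl/= xy|xy] := ltP (d x y) dl.
  by rewrite -[leLHS]addr0 lerD ?mulr_ge0// le_min n1 ltW.
rewrite -[leLHS]add0r lerD ?le_min ?ler0n ?h0//.
by rewrite (@le_trans _ _ (n%:R * dl)) ?ler_wpM2l// -ler_pdivrMr.
Unshelve. all: by end_near.
Qed.

End borel_space_metric.

(** * Integrals of upper semicontinuous functions *)

Section usc_operations.
Context {R : realType} {T : topologicalType} (K : set T).
Implicit Types f g : T -> R.

Lemma usc_onD f g : usc_on K f -> usc_on K g -> usc_on K (fun x => f x + g x).
Proof.
move=> uf ug x Kx a fga; pose e := (a - (f x + g x)) / 2.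
have e0 : 0 < e by rewrite divr_gt0// subr_gt0.
have fe : f x < f x + e by rewrite ltrDl.
have ge : g x < g x + e by rewrite ltrDl.
apply: filterS2 (uf x Kx _ fe) (ug x Kx _ ge) => y fy gy Ky.
by have := fy Ky; have := gy Ky; rewrite /e; lra.
Qed.

Lemma usc_onZ f (c : R) : 0 <= c -> usc_on K f -> usc_on K (fun x => c * f x).
Proof.
rewrite le_eqVlt => /predU1P[<-|c0] uf x Kx a.
  by rewrite mul0r => a0; apply: nearW => y _; rewrite mul0r.
rewrite mulrC -ltr_pdivlMr// => /(uf x Kx); apply: filterS => y /[apply].
by rewrite ltr_pdivlMr// mulrC.
Qed.

Lemma usc_on_powR f p : 0 < p -> (forall x, K x -> 0 <= f x) -> usc_on K f ->
  usc_on K (fun x => f x `^ p).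
Proof.
move=> p0 f0 uf x Kx a fa; have a0 : 0 < a := le_lt_trans (powR_ge0 _ _) fa.
have aE : (a `^ p^-1) `^ p = a.
  by rewrite -powRrM mulVf ?gt_eqF// powRr1// ltW.
have : f x < a `^ p^-1.
  rewrite ltNge; apply/negP => /(ge0_ler_powR (ltW p0)).
  by rewrite !nnegrE powR_ge0 f0// aE leNgt fa => /(_ isT isT).
move/(uf x Kx); apply: filterS => y /[swap] Ky /(_ Ky) fy.
by rewrite -aE gt0_ltr_powR// nnegrE ?powR_ge0 ?f0.
Qed.

End usc_operations.

Section integral_usc.
Context {R : realType} {S A : ptopologicalType}.

Lemma usc_measurable (f : S -> R) : upper_semicontinuous f ->
  measurable_fun [set: borel S] (f : borel S -> R).
Proof.
move=> /usc_open uf; apply: (measurability _ (RGenInftyO.measurableE R)).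
move=> /= _ [_ [a ->]] <-; rewrite setTI; apply: sub_sigma_algebra => /=.
by rewrite preimage_itvNyo; exact: uf.
Qed.

Lemma continuous_usc (f : S -> R) : continuous f -> upper_semicontinuous f.
Proof.
move=> cf x a fa; have /cvgrPdist_lt/(_ (a - f x)) := cf x.
rewrite subr_gt0 => /(_ fa); apply: filterS => y.
by rewrite ltr_norml; lra.
Qed.

(* The domination by [L * g] turns [V] into the nonnegative lower semicontinuous
   function [L * g - V], an increasing limit of bounded continuous functions to
   which the Feller property applies. *)
Lemma Feller_integral_usc (K : set (S * A)) (q : S * A -> probability (borel S) R)
    (g V : S -> R) (L : R) :
  borel_space R S -> feller K q -> continuous g -> (forall s, 0 <= g s) ->
  (forall k, K k -> (\int[q k]_s (g s)%:E < +oo)%E) ->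
  {within K, continuous (fun k => \int[q k]_s (g s)%:E)%E} ->
  (forall s, 0 <= V s <= L * g s) -> upper_semicontinuous V ->
  usc_on K (fun k => \int[q k]_s V s).
Proof.
move=> bS fq cg g0 gfin gcont V0L uV k0 Kk0 a Va.
have mg := usc_measurable (continuous_usc cg).
have mV := usc_measurable uV.
pose h s := L * g s - V s.
have h0 s : 0 <= h s by rewrite subr_ge0; case/andP: (V0L s).
have mh : measurable_fun [set: borel S] (h : borel S -> R).
  by apply: measurable_funB => //; exact: measurable_funM.
have lh x b : b < h x -> \forall y \near x, b < h y.
  move=> bh; have cLg : continuous (fun y => - (L * g y)).
    by move=> y; apply: cvgN; apply: cvgMl_tmp; exact: cg.
  have := usc_onD (usc_onT uV) (usc_onT (continuous_usc cLg)).
  move=> /(_ x I (- b)); rewrite ltrNr opprD opprK addrC => /(_ bh).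
  by apply: filterS => y /(_ I); rewrite ltrNr opprD opprK addrC.
have [hn [hnc hnb hnd hnh hncv]] := lsc_approx bS h0 lh.
have gint k : K k -> (q k).-integrable setT (EFin \o g).
  move=> Kk; apply/integrableP; split; first exact/measurable_EFinP.
  by under eq_integral do rewrite /= ger0_norm//; exact: gfin.
have domint k (f : borel S -> R) : K k -> measurable_fun setT f ->
    (forall s, 0 <= f s <= L * g s) -> (q k).-integrable setT (EFin \o f).
  move=> Kk mf fL.
  apply: (@le_integrable _ _ _ _ _ _ _ (EFin \o (fun s : borel S => L * g s))) => //.
  - exact/measurable_EFinP.
  - move=> s _ /=; rewrite lee_fin; have /andP[f0 fLg] := fL s.
    by rewrite !ger0_norm// (le_trans f0).
  - have -> : EFin \o (fun s => L * g s) = (fun s => L%:E * (EFin \o g) s)%E by [].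
    by apply: integrableZl => //; exact: gint.
have mhn n : measurable_fun [set: borel S] (hn n : borel S -> R).
  exact: usc_measurable (continuous_usc (hnc n)).
have hnL n s : 0 <= hn n s <= L * g s.
  have /andP[-> _] := hnb n s; rewrite (le_trans (hnh n s))//.
  by rewrite gerBl; case/andP: (V0L s).
have hL s : 0 <= h s <= L * g s.
  by rewrite h0 gerBl; case/andP: (V0L s).
have VE k : K k -> \int[q k]_s V s = L * (\int[q k]_s g s) - \int[q k]_s h s.
  move=> Kk; rewrite -RintegralZl//; last exact: gint.
  rewrite -RintegralB//; [|exact: integrableZl (gint _ Kk)|exact: domint].
  by apply: eq_Rintegral => s _; rewrite opprB addrC subrK.
have cvh : \int[q k0]_s hn n s @[n --> \oo] --> \int[q k0]_s h s.
  apply: fine_cvg; rewrite fineK; last exact/integrable_fin_num/domint.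
  have -> : (\int[q k0]_s (h s)%:E = \int[q k0]_s limn (fun n => (hn n s)%:E))%E.
    apply: eq_integral => s _; apply/esym/cvg_lim => //.
    by apply/cvg_EFin; [exact: nearW|exact: hncv].
  apply: cvg_monotone_convergence => //.
  - by move=> n; exact/measurable_EFinP.
  - by move=> n s _; rewrite lee_fin; case/andP: (hnb n s).
  - by move=> s _ m n mn; rewrite lee_fin; exact: hnd.
have [n na] : exists n, L * (\int[q k0]_s g s) - a < \int[q k0]_s hn n s.
  have : L * (\int[q k0]_s g s) - a < \int[q k0]_s h s.
    by move: Va; rewrite VE//; lra.
  move=> /(cvgr_gt _ cvh)[n _ nP]; exists n; exact: (nP n (leqnn n)).
(* [- f] is continuous at [k0] relative to [K], lies below [a] there, and majorises the integral of
   [V] on [K] because [hn n <= h]. *)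
pose f k := \int[q k]_s hn n s - L * \int[q k]_s g s.
have cf : f @ within K (nbhs k0) --> f k0.
  apply: cvgB.
    have hnB : exists C, forall s, `|hn n s| <= C.
      by exists n%:R => s; case/andP: (hnb n s) => ? ?; rewrite ger0_norm.
    by move/subspace_continuousP : (fq _ (hnc n) hnB); exact.
  apply: cvgZl_tmp; apply: fine_cvg; rewrite fineK.
    by move/subspace_continuousP: gcont; exact.
  exact/integrable_fin_num/gint.
have : - a < f k0 by rewrite /f; lra.
move=> /(cvgr_gt _ cf); apply: (@filterS _ (nbhs k0)) => k /= fk Kk; move: {fk}(fk Kk).
rewrite VE// /f => fk.
have : \int[q k]_s hn n s <= \int[q k]_s h s.
  by apply: le_Rintegral => //; exact: domint.
by move: fk; lra.
Qed.

End integral_usc.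

(** * Power means and Minkowski's inequality *)

Section power_mean.
Context d (T : measurableType d) (R : realType).
Variables (mu : {measure set T -> \bar R}) (p : R) (omega : T -> R) (B : R).
Hypothesis p1 : 1 <= p.
Hypothesis momega : measurable_fun [set: T] omega.
Hypothesis omega0 : forall s, 0 <= omega s.
Hypothesis omegaB : (\int[mu]_s (omega s `^ p)%:E <= B%:E)%E.
Implicit Types f g : T -> R.

(** The L^p norm of a nonnegative [f], as a real number. *)
Definition power_mean f := (\int[mu]_s (f s `^ p)) `^ p^-1.

Let p0 : 0 < p. Proof. exact: lt_le_trans ltr01 p1. Qed.

Lemma integrable_powR_dominated f (C : R) : measurable_fun [set: T] f ->
  (forall s, 0 <= f s <= C * omega s) ->
  mu.-integrable setT (fun s => (f s `^ p)%:E).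
Proof.
move=> mf fC; pose C' := `|C|.
have fC' s : 0 <= f s <= C' * omega s.
  have /andP[-> fs] := fC s; rewrite (le_trans fs)//.
  by rewrite ler_wpM2r// ler_norm.
apply: (@le_integrable _ _ _ _ _ measurableT _
    (fun s => (C' `^ p)%:E * (omega s `^ p)%:E)%E) => //.
- apply/measurable_EFinP.
  exact: (measurableT_comp (f := @powR R ^~ p)).
- move=> s _; rewrite -EFinM -powRM ?normr_ge0// !abse_EFin lee_fin.
  rewrite !ger0_norm ?powR_ge0//; have /andP[f0 fs] := fC' s.
  by rewrite ge0_ler_powR ?nnegrE ?(ltW p0)// mulr_ge0 ?normr_ge0.
apply: integrableZl => //; apply/integrableP; split.
  apply/measurable_EFinP.
  exact: (measurableT_comp (f := @powR R ^~ p)).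
under eq_integral do rewrite abse_EFin ger0_norm ?powR_ge0//.
exact: le_lt_trans omegaB (ltry _).
Qed.

Lemma Lnorm_power_mean f : (forall s, 0 <= f s) ->
  mu.-integrable setT (fun s => (f s `^ p)%:E) ->
  ('N[mu]_p%:E[EFin \o f] = (power_mean f)%:E)%E.
Proof.
move=> f0 intf; rewrite unlock /= /power_mean /Rintegral -poweR_EFin fineK.
  by congr poweR; apply: eq_integral => s _; rewrite ger0_norm// poweR_EFin.
exact: integrable_fin_num.
Qed.

(** Monotonicity, then Minkowski for [g + t * omega], where [omega] has norm at most the [p]-th root
    of [B]. The shift also supplies the integrability of the power of [f]. *)
Lemma power_mean_le_shift f g (L t : R) :
  measurable_fun [set: T] f -> measurable_fun [set: T] g ->
  (forall s, 0 <= f s) -> (forall s, 0 <= g s <= L * omega s) -> 0 <= t ->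
  (forall s, f s <= g s + t * omega s) ->
  power_mean f <= power_mean g + t * B `^ p^-1.
Proof.
move=> mf mg f0 g0L t0 fgt.
have B0 : 0 <= B.
  by rewrite -lee_fin (le_trans _ omegaB)// integral_ge0// => s _; rewrite lee_fin powR_ge0.
have mt : measurable_fun [set: T] (fun s => t * omega s) by exact: measurable_funM.
have g0 s : 0 <= g s by case/andP: (g0L s).
have t0' s : 0 <= t * omega s by rewrite mulr_ge0.
have gtL s : 0 <= g s + t * omega s <= (L + t) * omega s.
  by rewrite addr_ge0//= mulrDl lerD2r; case/andP: (g0L s).
have ig : mu.-integrable setT (fun s => (g s `^ p)%:E).
  exact: integrable_powR_dominated g0L.
have it : mu.-integrable setT (fun s => ((t * omega s) `^ p)%:E).
  by apply: (@integrable_powR_dominated _ t) => // s; rewrite t0' lexx.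
have io : mu.-integrable setT (fun s => (omega s `^ p)%:E).
  by apply: (@integrable_powR_dominated _ 1) => // s; rewrite omega0 mul1r lexx.
have igt : mu.-integrable setT (fun s => ((g s + t * omega s) `^ p)%:E).
  by apply: integrable_powR_dominated gtL; exact: measurable_funD.
have if_ : mu.-integrable setT (fun s => (f s `^ p)%:E).
  apply: (@integrable_powR_dominated _ (L + t)) => // s.
  by rewrite f0 (le_trans (fgt s))//; case/andP: (gtL s).
have pV0 : 0 <= p^-1 by rewrite invr_ge0 ltW.
have int0 h : 0 <= \int[mu]_s (h s `^ p).
  by apply: Rintegral_ge0 => s _; exact: powR_ge0.
apply: (@le_trans _ _ (power_mean (fun s => g s + t * omega s))).
  rewrite ge0_ler_powR ?nnegrE ?int0//.
  apply: le_Rintegral => // s _.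
  by rewrite ge0_ler_powR ?nnegrE ?(ltW p0)// (le_trans (f0 s)).
apply: (@le_trans _ _ (power_mean g + power_mean (fun s => t * omega s))).
  have := @minkowski_EFin _ _ _ mu _ _ _ mg mt p1.
  rewrite !Lnorm_power_mean//; first by move=> s /=; rewrite addr_ge0.
rewrite lerD2l /power_mean.
have -> : \int[mu]_s (t * omega s) `^ p = t `^ p * \int[mu]_s (omega s `^ p).
  rewrite -RintegralZl//; apply: eq_Rintegral => s _.
  by rewrite powRM.
rewrite powRM ?powR_ge0// -powRrM mulfV ?gt_eqF// powRr1//.
rewrite ler_wpM2l// ge0_ler_powR// ?nnegrE//.
by rewrite -lee_fin /Rintegral fineK//; exact: integrable_fin_num.
Qed.

Lemma power_mean0 : power_mean (fun=> 0) = 0.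
Proof.
rewrite /power_mean powR0 ?gt_eqF// /Rintegral.
by rewrite integral0 /= powR0// invr_eq0 gt_eqF.
Qed.

End power_mean.

(** * Measurable selection of maximisers *)

Section measurable_selection.

(* The values [phi s] are shrunk successively: at step [n] one intersects with
   [C n] whenever the intersection is nonempty. By compactness something remains
   in the end, and since the [C n] separate points it is a single point. *)
Lemma measurable_selection d (S : measurableType d) (A : ptopologicalType)
    (C : nat -> set A) (phi : S -> set A) :
  (forall n, closed (C n)) ->
  (forall x y, x != y -> exists n, C n x /\ ~ C n y) ->
  (forall s, compact (phi s)) -> (forall s, phi s !=set0) ->
  (forall D, closed D -> measurable [set s | phi s `&` D !=set0]) ->
  exists2 f : S -> A, measurable_fun [set: S] (f : S -> borel A) &
    forall s, phi s (f s).
Proof.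
move=> clC sepC cphi phi0 mphi.
(* The implication makes the new constraint [C n'] or the whole space, according to whether the
   intersection is nonempty. *)
pose fix E (n : nat) (s : S) {struct n} : set A := if n is n'.+1 then
  E n' s `&` [set a | phi s `&` (E n' s `&` C n') !=set0 -> C n' a] else setT.
have clE n s : closed (E n s).
  elim: n => [|n ih] /=; first exact: closedT.
  apply: closedI => //.
  have [H|H] := pselect (phi s `&` (E n s `&` C n) !=set0).
    rewrite (_ : [set _ | _] = C n)//; apply/seteqP; split => a /=; first exact.
    by move=> ? _.
  rewrite (_ : [set _ | _] = setT); first exact: closedT.
  by apply/seteqP; split => a //= _ /H.
have subE s m n : (m <= n)%N -> E n s `<=` E m s.
  elim: n => [|n ih]; first by rewrite leqn0 => /eqP ->.
  rewrite leq_eqVlt => /predU1P[-> //|]; rewrite ltnS => /ih; apply: subset_trans.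
  by move=> a [].
(* A test of stage [n.+1] against [D] reduces to tests of stage [n] against closed sets, so
   measurability follows by induction over all closed [D] at once. *)
have ES n s D : phi s `&` (E n.+1 s `&` D) !=set0 <->
    (phi s `&` (E n s `&` C n) !=set0 /\ phi s `&` (E n s `&` (C n `&` D)) !=set0) \/
    (~ (phi s `&` (E n s `&` C n) !=set0) /\ phi s `&` (E n s `&` D) !=set0).
  split.
    move=> [a [pa [[Ea Ca] Da]]].
    have [H|H] := pselect (phi s `&` (E n s `&` C n) !=set0).
      by left; split => //; exists a; do !split => //; exact: Ca.
    by right; split => //; exists a.
  move=> [[H [a [pa [Ea [Ca Da]]]]]|[H [a [pa [Ea Da]]]]].
    by exists a; do !split.
  by exists a; split => //; split => //; split => // /H.
have mE n D : closed D -> measurable [set s | phi s `&` (E n s `&` D) !=set0].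
  elim: n D => [|n ih] D clD.
    under eq_set do rewrite /= setTI.
    exact: mphi.
  rewrite (_ : [set _ | _] =
    ([set s | phi s `&` (E n s `&` C n) !=set0] `&`
      [set s | phi s `&` (E n s `&` (C n `&` D)) !=set0]) `|`
    (~` [set s | phi s `&` (E n s `&` C n) !=set0] `&`
      [set s | phi s `&` (E n s `&` D) !=set0])).
    apply: measurableU; apply: measurableI; try apply: measurableC; apply: ih => //.
    exact: closedI.
  by apply/seteqP; split => s /=; rewrite ES.
have nE n s : phi s `&` (E n s `&` setT) !=set0.
  elim: n => [|n ih]; first by have [a] := phi0 s; exists a.
  apply/ES; have [H|H] := pselect (phi s `&` (E n s `&` C n) !=set0).
    by left; split => //; rewrite setIT.
  by right.
have limE s D : closed D -> (forall n, phi s `&` (E n s `&` D) !=set0) ->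
    exists2 a, phi s a & forall n, (E n s `&` D) a.
  move=> clD nED.
  have [|||||a pa Ea] := @compact_nested _ _ setT (phi s) (fun n => E n s `&` D).
  - exact: cphi.
  - by exists 0%N.
  - by move=> n _; exact: closedI.
  - by move=> n _; exact: nED.
  - move=> i j _ _; exists (maxn i j) => // a [Ea Da].
    by split; split => //; apply: subE Ea; rewrite ?leq_maxl ?leq_maxr.
  by exists a => // n; exact: Ea.
have /choice[f fP] : forall s, exists a, phi s a /\ forall n, E n s a.
  move=> s; have [a pa Ea] := limE s setT (closedT) (nE ^~ s).
  by exists a; split => // n; case: (Ea n).
(* If [a] differs from [f s], some [C n] contains [a] but not [f s]; yet [a] shows that stage [n]
   meets [C n], which forces stage [n.+1] into [C n]. *)
have funiq s a : phi s a -> (forall n, E n s a) -> a = f s.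
  move=> pa Ea; apply/eqP/negPn/negP => /sepC[n [Ca]]; apply.
  have [pf /(_ n.+1)[_ /= Hn]] := fP s.
  by apply: Hn; exists a; split => //; split => //; exact: Ea.
exists f; last by move=> s; case: (fP s).
(* By compactness and uniqueness of the remaining point, [f s] lies in [D] exactly when every stage
   meets [D] within [phi s]. *)
have mfC D : closed D -> measurable (f @^-1` D).
  move=> clD; rewrite (_ : _ @^-1` _ =
    \bigcap_n [set s | phi s `&` (E n s `&` D) !=set0]).
    by apply: bigcapT_measurable => n; exact: mE.
  apply/seteqP; split => s /=.
    by move=> Df n _ /=; have [pf Ef] := fP s; exists (f s).
  move=> H; have [|a pa Ea] := limE s D clD; first by move=> n; exact: H.
  rewrite -(@funiq s a) //; first by case: (Ea 0%N).
  by move=> n; case: (Ea n).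
apply: (measurability _ (erefl : @measurable _ (borel A) = <<s @open A >>)).
move=> _ [U oU <-]; rewrite setTI -[U]setCK preimage_setC.
by apply: measurableC; exact: mfC (open_closedC oU).
Qed.

Lemma usc_on_section {R : realType} {S A : topologicalType} (K : set (S * A))
    (w : S * A -> R) (s : S) :
  usc_on K w -> usc_on [set a | K (s, a)] (fun a => w (s, a)).
Proof.
move=> uw a Ka b wb; have [[U W] /= [nU nW] UW] := uw _ Ka b wb.
apply: filterS nW => a' Wa' Ka'; apply: (UW (s, a')) => //; split => //=.
exact: nbhs_singleton.
Qed.

Lemma argmax_selection {R : realType} {S A : ptopologicalType} (K : set (S * A))
    (w : S * A -> R) (m : S -> R) :
  borel_space R A -> (forall s, compact (actions K s)) ->
  usc_correspondence (actions K) -> usc_on K w ->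
  (forall s, is_max [set w (s, a) | a in actions K s] (m s)) ->
  exists2 f : S -> A, policy K f & forall s, w (s, f s) = m s.
Proof.
move=> /borel_space_separating[C [clC sepC]] cA uA uw mP.
have wm s a : K (s, a) -> w (s, a) <= m s.
  by move=> Ka; have [_] := mP s; apply; exists a.
(* Intersecting with a closed [D] preserves compactness and upper semicontinuity of the
   correspondence, so Berge's argument still applies. *)
have oD D (r : R) : closed D ->
    open [set s | forall a, actions K s a -> D a -> w (s, a) < r].
  move=> clD; rewrite (_ : [set _ | _] =
      [set s | forall a, (actions K s `&` D) a -> w (s, a) < r]).
    apply: (@berge_open _ _ _ K (fun s => actions K s `&` D)) => //.
    - by move=> s; exact: compact_closedI.
    - move=> D' clD'; under eq_set do rewrite -setIA.
      by apply: uA; exact: closedI.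
    - by move=> s a [].
  by apply/seteqP; split => s /= H a; [case; exact: H|move=> ? ?; exact: H].
pose phi s := actions K s `&` [set a | m s <= w (s, a)].
have [|||f mf fphi] := @measurable_selection _ (borel S) A C phi clC sepC.
- move=> s; apply: (@compact_usc_ge _ _ _ (fun a => w (s, a))) => //.
  exact: usc_on_section.
- by move=> s; have [[a Ka wa] _] := mP s; exists a; split => //=; rewrite wa.
- move=> D clD; pose N (r : R) := [set s | forall a, actions K s a -> D a -> w (s, a) < r].
  pose N' (r : R) := [set s | forall a, actions K s a -> setT a -> w (s, a) < r].
  (* The maximum of [w (s, _)] over [D] is smaller than [m s] iff a rational
     separates the two. *)
  rewrite (_ : [set _ | _] = ~` \bigcup_(r : rat) (N (ratr r) `\` N' (ratr r))).
    apply: measurableC; apply: bigcupT_measurable_rat => r.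
    by apply: measurableD; apply: sub_sigma_algebra; apply: oD => //; exact: closedT.
  apply/seteqP; split => [s [a [[Ka ma] Da]] [r _ [Nr]]|s /= H].
    apply => a' Ka' _; rewrite (le_lt_trans (wm _ _ Ka'))// (le_lt_trans ma)//.
    exact: Nr.
  apply: contrapT => phiD; apply: H.
  have wlt a : actions K s a -> D a -> w (s, a) < m s.
    by move=> Ka Da; rewrite ltNge; apply/negP => ma; apply: phiD; exists a.
  have mge r : r <= m s -> ~ N' r s.
    have [[a Ka <-] _] := mP s.
    by move=> rw /(_ a Ka I); rewrite ltNge rw.
  (* Attainment over [D] turns the pointwise strict inequalities into a gap that contains a
     rational; if no feasible action lies in [D], any rational below [m s] will do. *)
  have [[a0 [Ka0 Da0]]|noD] := pselect (actions K s `&` D !=set0).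
    have [|||a [Ka Da] amax] := @usc_on_max _ _ (actions K s `&` D) (fun a => w (s, a)).
    + exact: compact_closedI.
    + by exists a0.
    + by move=> a [Ka Da] b wb; apply: filterS (usc_on_section uw Ka wb) => y + [Ky _]; exact.
    have [r] := rat_in_itvoo (wlt a Ka Da); rewrite in_itv/= => /andP[war rm].
    exists r => //; split; last by apply: mge; exact: ltW.
    by move=> a' Ka' Da'; apply: le_lt_trans war; exact: amax.
  have [r] : exists r : rat, ratr r \in `]m s - 1, m s[.
    by apply: rat_in_itvoo; rewrite gtrBl.
  rewrite in_itv/= => /andP[_ rm].
  exists r => //; split; last by apply: mge; exact: ltW.
  by move=> a' Ka' Da'; exfalso; apply: noD; exists a'.
exists f; first by split => // s; have [] := fphi s.
by move=> s; have [Kf mf'] := fphi s; apply/eqP; rewrite eq_le mf' wm.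
Qed.

End measurable_selection.

(** * The operator F2 *)

Lemma is_max_sup (R : realType) (E : set R) m : is_max E m -> sup E = m.
Proof.
move=> [Em ub]; apply/eqP; rewrite eq_le; apply/andP; split.
  by apply: ge_sup => //; exists m.
by apply: ub_le_sup => //; exists m.
Qed.

Lemma is_max_image_powR (R : realType) (E : set R) m p : 0 < p ->
  (forall x, E x -> 0 <= x) -> is_max E m -> is_max [set x `^ p | x in E] (m `^ p).
Proof.
move=> p0 E0 [Em ub]; split; first by exists m.
move=> _ [x Ex <-]; apply: ge0_ler_powR; rewrite ?nnegrE ?(ltW p0) ?(E0 x) ?(E0 m)//; exact: ub.
Qed.

Lemma cvg_geometric_shift (R : realType) (delta y e : R) :
  0 <= delta -> delta < 1 -> y + delta ^+ n * e @[n --> \oo] --> y.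
Proof.
move=> d0 d1; rewrite -[X in _ --> X](addr0 y) -(mul0r e).
apply: cvgD; first exact: cvg_cst.
by apply: cvgMr_tmp; apply: cvg_expr; rewrite ger0_norm.
Qed.

Lemma ler_geometric_shift (R : realType) (delta x y e : R) :
  0 <= delta -> delta < 1 -> (forall n, x <= y + delta ^+ n * e) -> x <= y.
Proof.
move=> d0 d1 H; have := cvgr_to_ge (@cvg_geometric_shift _ delta y e d0 d1); apply.
exact: nearW.
Qed.

(** * The weighted supremum norm and one-sided bounds *)

Section weighted_norm.
Context {R : realType} {S : ptopologicalType} (omega : S -> R).
Hypothesis omega_ge1 : forall s, 1 <= omega s.
Implicit Types v : S -> R.

Let omega_gt0 s : 0 < omega s. Proof. exact: lt_le_trans ltr01 (omega_ge1 s). Qed.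

Lemma wnorm_leP v L :
  (wnorm omega v <= L%:E)%E <-> forall s, `|v s| <= L * omega s.
Proof.
split=> [vL s|vL].
  rewrite -ler_pdivrMr// -lee_fin; apply: le_trans vL.
  by apply: ereal_sup_ubound; exists s.
by apply: ge_ereal_sup => _ [s _ <-]; rewrite lee_fin ler_pdivrMr.
Qed.

Lemma wnorm_finP v :
  (wnorm omega v < +oo)%E -> exists2 L, 0 <= L & wnorm omega v = L%:E.
Proof.
(* The base point keeps the range nonempty; the supremum of the empty set would be [-oo]. *)
move=> voo; have v0 : (0 <= wnorm omega v)%E.
  apply: (@le_trans _ _ (`|v point| / omega point)%:E).
    by rewrite lee_fin divr_ge0// ltW.
  by apply: ereal_sup_ubound; exists point.
exists (fine (wnorm omega v)); first exact: fine_ge0.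
by rewrite fineK// ge0_fin_numE.
Qed.

Lemma wnorm_lty_le v : (wnorm omega v < +oo)%E ->
  exists2 L, 0 <= L & forall s, v s <= L * omega s.
Proof.
move=> /wnorm_finP[L L0 vL]; exists L => // s.
have /wnorm_leP/(_ s) : (wnorm omega v <= L%:E)%E by rewrite vL.
exact/le_trans/ler_norm.
Qed.

(** Starting from [t = L], which is admissible since [V2] is nonnegative, [n] steps leave an excess
    of [delta ^+ n * L * omega], which tends to zero. *)
Lemma le_of_contracted_shift (delta L : R) (V1 V2 : S -> R) :
  0 <= delta -> delta < 1 -> 0 <= L ->
  (forall s, 0 <= V2 s) -> (forall s, V1 s <= L * omega s) ->
  (forall t, 0 <= t -> (forall s, V1 s <= V2 s + t * omega s) ->
     forall s, V1 s <= V2 s + delta * t * omega s) ->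
  forall s, V1 s <= V2 s.
Proof.
move=> d0 d1 L0 V20 V1L step s.
apply: (@ler_geometric_shift _ delta _ _ (L * omega s)) => // n.
elim: n s => [|n ih] s; first by rewrite expr0 mul1r (le_trans (V1L s))// lerDr.
rewrite (_ : _ * _ = delta * (delta ^+ n * L) * omega s); last by rewrite exprS; ring.
apply: step => [|s']; first by rewrite mulr_ge0// exprn_ge0.
by rewrite -mulrA; exact: ih.
Qed.

End weighted_norm.

(** * One-step estimates, semicontinuity and contraction of [F2] *)

Section dynamic_program.
Context {R : realType} {S A : ptopologicalType} (K : set (S * A)).
Context (q : S * A -> probability (borel S) R) (u : S * A -> R).
Context (beta rho theta : R) (omega : S -> R) (M c : R).
Hypothesis borelS : borel_space R S.
Hypothesis A_neq0 : forall s, actions K s !=set0.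
Hypothesis q_feller : feller K q.
Hypothesis u_ge0 : forall k, K k -> 0 <= u k.
Hypothesis u_usc : upper_semicontinuous (u : subspace K -> R).
Hypothesis beta_ge0 : 0 <= beta.
Hypothesis beta_lt1 : beta < 1.
Hypothesis rho_lt1 : rho < 1.
Hypothesis theta_ge1 : 1 <= theta.
Hypothesis omega_ge1 : forall s, 1 <= omega s.
Hypothesis omega_cont : continuous omega.
Hypothesis M_gt0 : 0 < M.
Hypothesis c_ge1 : 1 <= c.
Hypothesis A_compact : forall s, compact (actions K s).
Hypothesis A_usc : usc_correspondence (actions K).
Hypothesis r_le : forall k, K k -> reward beta rho u k <= M * omega k.1.
Hypothesis omega_int_cont :
  {within K, continuous (fun k => (\int[q k]_s (omega s `^ theta)%:E)%E)}.
Hypothesis omega_int_le : forall k, K k ->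
  (\int[q k]_s (omega s `^ theta)%:E <= (c * omega k.1 `^ theta)%:E)%E.

Local Notation delta := (c `^ theta^-1 * beta).
Hypothesis c_beta : delta < 1.

Local Notation Q := (F2_objective beta rho theta u q).
Local Notation T := (F2 beta rho theta K u q).
Implicit Types V : S -> R.

Let theta_gt0 : 0 < theta. Proof. exact: lt_le_trans ltr01 theta_ge1. Qed.
Let omega_gt0 s : 0 < omega s. Proof. exact: lt_le_trans ltr01 (omega_ge1 s). Qed.
Let omega_ge0 s : 0 <= omega s. Proof. exact: ltW. Qed.
Let delta_ge0 : 0 <= delta. Proof. by rewrite mulr_ge0// powR_ge0. Qed.

Let momega : measurable_fun [set: borel S] (omega : borel S -> R).
Proof. exact: usc_measurable (continuous_usc omega_cont). Qed.

Lemma reward_ge0 k : 0 <= reward beta rho u k.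
Proof. by rewrite mulr_ge0 ?powR_ge0// subr_ge0 ltW. Qed.

Lemma F2_objective_ge0 V k : 0 <= Q V k.
Proof. by rewrite addr_ge0 ?reward_ge0// mulr_ge0 ?powR_ge0. Qed.

(** Minkowski's estimate with [B] equal to [c] times the power of [omega]: its root contributes the
    factor of [c] in [delta], and discounting contributes [beta]. Borel functions are allowed, for
    later use along a single policy. *)
Lemma F2_objective_le_shift V1 V2 L t k : K k ->
  measurable_fun [set: borel S] (V1 : borel S -> R) ->
  measurable_fun [set: borel S] (V2 : borel S -> R) ->
  (forall s, 0 <= V1 s) -> (forall s, 0 <= V2 s <= L * omega s) -> 0 <= t ->
  (forall s, V1 s <= V2 s + t * omega s) ->
  Q V1 k <= Q V2 k + delta * t * omega k.1.
Proof.
move=> Kk mV1 mV2 V10 V2L t0 V12; rewrite /F2_objective -addrA lerD2l.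
have := @power_mean_le_shift _ (borel S) R (q k) theta omega _ theta_ge1 momega
  omega_ge0 (omega_int_le Kk) V1 V2 L t mV1 mV2 V10 V2L t0 V12.
rewrite powRM ?powR_ge0 ?(le_trans ler01)// -powRrM mulfV ?gt_eqF// powRr1//.
move=> /(ler_wpM2l beta_ge0)/le_trans; apply.
by rewrite mulrDr lerD2l le_eqVlt; apply/orP; left; apply/eqP; ring.
Qed.

Lemma F2_objective0 k : Q (fun=> 0) k = reward beta rho u k.
Proof.
rewrite /F2_objective -/(power_mean (q k) theta (fun=> 0)).
by rewrite (power_mean0 (q k) theta_ge1) mulr0 addr0.
Qed.

Lemma F2_objective_le V L k : K k ->
  measurable_fun [set: borel S] (V : borel S -> R) -> 0 <= L ->
  (forall s, 0 <= V s <= L * omega s) ->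
  Q V k <= (M + delta * L) * omega k.1.
Proof.
move=> Kk mV L0 VL; rewrite mulrDl.
apply: (@le_trans _ _ (Q (fun=> 0) k + delta * L * omega k.1)).
  apply: (@F2_objective_le_shift V (fun=> 0) 0) => // s; try by case/andP: (VL s).
    by rewrite lexx mul0r lexx.
  by rewrite add0r; case/andP: (VL s).
by rewrite lerD2r F2_objective0 r_le.
Qed.

Lemma Bplus_bounded V : Bplus omega V ->
  exists2 L, 0 <= L & forall s, 0 <= V s <= L * omega s.
Proof.
move=> [V0 _ /(wnorm_lty_le omega_ge1)[L L0 VL]]; exists L => // s.
by rewrite V0 VL.
Qed.

Lemma Uplus_intro V L : (forall s, 0 <= V s <= L * omega s) ->
  upper_semicontinuous V -> Uplus omega V.
Proof.
move=> VL uV; split => //; first by move=> s; case/andP: (VL s).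
apply: (@le_lt_trans _ _ L%:E); last exact: ltry.
by apply/(wnorm_leP omega_ge1) => s; case/andP: (VL s) => V0; rewrite ger0_norm.
Qed.

Lemma Uplus_Bplus V : Uplus omega V -> Bplus omega V.
Proof. by move=> [V0 uV Voo]; split => //; exact: usc_measurable. Qed.

Lemma Uplus_bounded V : Uplus omega V ->
  exists2 L, 0 <= L & forall s, 0 <= V s <= L * omega s.
Proof. by move=> /Uplus_Bplus/Bplus_bounded. Qed.

Lemma F2_objective_usc V : Uplus omega V -> usc_on K (Q V).
Proof.
move=> UV; have [L L0 VL] := Uplus_bounded UV; case: UV => V0 uV _.
have cpow : continuous (fun s => omega s `^ theta).
  move=> s; apply: (@continuous_comp _ _ _ omega (@powR R ^~ theta)); first exact: omega_cont.
  apply/differentiable_continuous/derivable1_diffP.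
  by apply: derivable_powR; rewrite in_itv/= omega_gt0.
apply: usc_onD.
  apply: usc_onZ; first by rewrite subr_ge0 ltW.
  by apply: usc_on_powR => //; [rewrite subr_gt0|exact: usc_on_subspace].
apply: usc_onZ => //; apply: usc_on_powR; first by rewrite invr_gt0.
  by move=> k _; apply: Rintegral_ge0 => s _; exact: powR_ge0.
(* The bound [V <= L * omega], raised to the power [theta], gives the required continuous dominating
   function. *)
apply: (@Feller_integral_usc _ _ _ K q (fun s => omega s `^ theta) _ (L `^ theta)) => //.
- by move=> s; exact: powR_ge0.
- by move=> k Kk; exact: le_lt_trans (omega_int_le Kk) (ltry _).
- move=> s; rewrite powR_ge0/= -powRM// ge0_ler_powR ?nnegrE ?(ltW theta_gt0)//.
    by rewrite mulr_ge0.
  by case/andP: (VL s).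
move=> x a Va; have := usc_on_powR theta_gt0 (fun s _ => V0 s) (usc_onT uV).
by move=> /(_ x I a Va); apply: filterS => y; exact.
Qed.

Lemma F2_is_max V s : Uplus omega V ->
  is_max [set Q V (s, a) | a in actions K s] (T V s).
Proof.
move=> UV.
have [a Ka amax] := usc_on_max (@A_compact s) (A_neq0 s)
  (usc_on_section (F2_objective_usc UV)).
have m : is_max [set Q V (s, a) | a in actions K s] (Q V (s, a)).
  by split; [exists a|move=> _ [b Kb <-]; exact: amax].
by rewrite /F2 (is_max_sup m).
Qed.

Lemma F2_ge V s a : Uplus omega V -> K (s, a) -> Q V (s, a) <= T V s.
Proof. by move=> /F2_is_max-/(_ s)[_ ub] Ka; apply: ub; exists a. Qed.

Lemma F2_attained V s : Uplus omega V -> exists2 a, K (s, a) & T V s = Q V (s, a).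
Proof. by move=> /F2_is_max-/(_ s)[[a Ka aE] _]; exists a. Qed.

Lemma F2_bounds V L s : Uplus omega V -> 0 <= L -> (forall s, V s <= L * omega s) ->
  0 <= T V s <= (M + delta * L) * omega s.
Proof.
move=> UV L0 VL; have [a Ka ->] := F2_attained s UV.
rewrite F2_objective_ge0 /=; have [V0 uV _] := UV.
apply: (@F2_objective_le V L (s, a)) => //; first exact: usc_measurable.
by move=> s'; rewrite V0 VL.
Qed.

(** Since the supremum is attained, [T V s < r] means that every feasible objective is below [r],
    which is the open condition of Berge's theorem. *)
Lemma F2_Uplus V : Uplus omega V -> Uplus omega (T V).
Proof.
move=> UV; have [L L0 VL] := Uplus_bounded UV.
apply: (@Uplus_intro _ (M + delta * L)).
  by move=> s; apply: F2_bounds => // s'; case/andP: (VL s').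
apply/usc_open => r; rewrite (_ : [set _ | _] =
    [set s | forall a, actions K s a -> Q V (s, a) < r]).
  exact: berge_open (F2_objective_usc UV).
apply/seteqP; split => s /=.
  by move=> Tr a Ka; exact: le_lt_trans (F2_ge UV Ka) Tr.
by move=> H; have [a Ka ->] := F2_attained s UV; exact: H.
Qed.

Lemma F2_le_shift V1 V2 t : Uplus omega V1 -> Uplus omega V2 -> 0 <= t ->
  (forall s, V1 s <= V2 s + t * omega s) ->
  forall s, T V1 s <= T V2 s + delta * t * omega s.
Proof.
move=> U1 U2 t0 V12 s; have [a Ka ->] := F2_attained s U1.
apply: (@le_trans _ _ (Q V2 (s, a) + delta * t * omega s)); last first.
  by rewrite lerD2r F2_ge.
have [L L0 V2L] := Uplus_bounded U2.
have [V10 uV1 _] := U1; have [V20 uV2 _] := U2.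
by apply: (@F2_objective_le_shift V1 V2 L t (s, a)) => //; exact: usc_measurable.
Qed.

(** The norm of the difference is a finite [t], and the two one-sided shifts by [t] together give
    the absolute value estimate. *)
Lemma F2_contraction : contraction_on (Uplus omega)
  (fun V1 V2 => wnorm omega (fun s => V1 s - V2 s)) delta T.
Proof.
split=> [V|V1 V2 U1 U2]; first exact: F2_Uplus.
have [L1 L10 V1L] := Uplus_bounded U1; have [L2 L20 V2L] := Uplus_bounded U2.
have [|t t0 tE] := @wnorm_finP _ _ omega omega_ge1 (fun s => V1 s - V2 s).
  apply: (@le_lt_trans _ _ (L1 + L2)%:E); last exact: ltry.
  apply/(wnorm_leP omega_ge1) => s; rewrite ler_norml.
  move: (V1L s) (V2L s) => /andP[? ?] /andP[? ?]; rewrite mulrDl.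
  by apply/andP; split; lra.
have /(wnorm_leP omega_ge1) V12 : (wnorm omega (fun s => V1 s - V2 s)%R <= t%:E)%E.
  by rewrite tE.
have V1V2 s : V1 s <= V2 s + t * omega s /\ V2 s <= V1 s + t * omega s.
  by move: (V12 s); rewrite ler_norml => /andP[? ?]; split; lra.
have H1 := F2_le_shift U1 U2 t0 (fun s => (V1V2 s).1).
have H2 := F2_le_shift U2 U1 t0 (fun s => (V1V2 s).2).
rewrite tE -EFinM; apply/(wnorm_leP omega_ge1) => s; rewrite ler_norml.
move: (T V1 s) (T V2 s) (delta * t * omega s) {H1 H2}(H1 s) (H2 s) => x y e.
by lra.
Qed.

(** * Iteration from zero and the fixed point *)

Let Uplus0 : Uplus omega (fun=> 0).
Proof.
apply: (@Uplus_intro _ 0) => [s|x a a0]; first by rewrite mul0r lexx.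
exact: nearW.
Qed.

Local Notation w n := (iter n T (fun=> 0)).
(** The solution of [b = M + delta * b], so that the bound [b * omega] is preserved by [F2]. *)
Local Notation b := (M / (1 - delta)).

Let b_ge0 : 0 <= b. Proof. by apply: divr_ge0; rewrite ?subr_ge0 ltW. Qed.

Lemma F2_iter_Uplus n : Uplus omega (w n).
Proof. by elim: n => [|n ih] /=; [exact: Uplus0|exact: F2_Uplus]. Qed.

Lemma F2_iter_bounded n s : w n s <= b * omega s.
Proof.
elim: n s => [|n ih] s /=; first by rewrite mulr_ge0.
have /andP[_ /le_trans] := F2_bounds s (F2_iter_Uplus n) b_ge0 ih; apply.
rewrite ler_wpM2r// le_eqVlt; apply/orP; left; apply/eqP.
have : 1 - delta != 0 by rewrite subr_eq0 gt_eqF.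
by move: delta => d d1; field.
Qed.

Lemma F2_iter_le n k s : w n s <= w (n + k) s.
Proof.
elim: n s => [|n ih] s; first by case: (F2_iter_Uplus (0 + k)).
(* Monotonicity of [F2] is the shift estimate with [t = 0]. *)
rewrite addSn /= -[leRHS]addr0 -[X in _ + X](mul0r (omega s)) -[X in X * _](mulr0 delta).
apply: F2_le_shift => //; try exact: F2_iter_Uplus.
by move=> s'; rewrite mul0r addr0.
Qed.

Lemma F2_iter_shift n k s : w (n + k) s <= w n s + delta ^+ n * b * omega s.
Proof.
elim: n s => [|n ih] s; first by rewrite add0n add0r expr0 mul1r F2_iter_bounded.
rewrite addSn /= exprS -(mulrA delta).
apply: F2_le_shift => //; try exact: F2_iter_Uplus.
by rewrite mulr_ge0// exprn_ge0.
Qed.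

Definition F2_limit s := sup [set w n s | n in [set: nat]].
Local Notation wstar := F2_limit.

Lemma F2_iter_le_limit n s : w n s <= wstar s.
Proof.
apply: ub_le_sup; last by exists n.
by exists (b * omega s) => _ [m _ <-]; exact: F2_iter_bounded.
Qed.

Lemma F2_limit_le_iter n s : wstar s <= w n s + delta ^+ n * b * omega s.
Proof.
apply: ge_sup; first by exists (w 0%N s); exists 0%N.
move=> _ [m _ <-]; have [mn|/ltnW nm] := leqP m n.
  rewrite -(subnKC mn) (le_trans (F2_iter_le m (n - m) s))// lerDl.
  by apply: mulr_ge0 => //; apply: mulr_ge0 => //; exact: exprn_ge0.
by rewrite -{1}(subnKC nm) F2_iter_shift.
Qed.

(** A supremum of upper semicontinuous functions need not be one; here it is also the infimum of the
    upper semicontinuous majorants [w n + delta ^+ n * b * omega]. *)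
Lemma F2_limit_Uplus : Uplus omega wstar.
Proof.
apply: (@Uplus_intro _ b).
  move=> s; rewrite (le_trans _ (F2_iter_le_limit 0 s))//=.
  by rewrite (le_trans (F2_limit_le_iter 0 s))//= add0r expr0 mul1r.
move=> x a wa.
have [n nP] : exists n, w n x + delta ^+ n * b * omega x < a.
  have /cvgr_lt/(_ _ wa)[n _ /(_ n (leqnn n)) nP] :=
    @cvg_geometric_shift _ delta (wstar x) (b * omega x) delta_ge0 c_beta.
  by exists n; rewrite -mulrA (le_lt_trans _ nP)// lerD2r F2_iter_le_limit.
have [_ un _] := F2_iter_Uplus n.
have uo := continuous_usc omega_cont.
have t0 : 0 <= delta ^+ n * b by rewrite mulr_ge0// exprn_ge0.
have := usc_onD (usc_onT un) (usc_onZ t0 (usc_onT uo)).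
move=> /(_ x I a nP); apply: filterS => y /(_ I).
exact/le_lt_trans/F2_limit_le_iter.
Qed.

(** Both sides are compared with [w n.+1]; each inequality holds up to [delta ^+ n.+1 * b * omega],
    which vanishes in the limit. *)
Lemma F2_limit_fixed : T wstar = wstar.
Proof.
apply/funext => s; apply/eqP; rewrite eq_le.
have Uw := F2_limit_Uplus; have Un := F2_iter_Uplus.
apply/andP; split; apply: (@ler_geometric_shift _ delta _ _ (delta * b * omega s)) => // n.
  apply: (@le_trans _ _ (w n.+1 s + delta ^+ n * (delta * b * omega s))).
    rewrite (_ : _ * (_ * _ * _) = delta * (delta ^+ n * b) * omega s); last by ring.
    apply: (F2_le_shift Uw (Un n)); first by rewrite mulr_ge0// exprn_ge0.
    by move=> s'; exact: F2_limit_le_iter.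
  by rewrite lerD2r F2_iter_le_limit.
rewrite (le_trans (F2_limit_le_iter n.+1 s))// exprS.
rewrite (_ : delta * _ * _ * _ = delta ^+ n * (delta * b * omega s)); last by ring.
rewrite lerD2r /= -[leRHS]addr0 -[X in _ + X](mul0r (omega s)) -[X in X * _](mulr0 delta).
apply: (F2_le_shift (Un n) Uw) => // s'.
by rewrite mul0r addr0 F2_iter_le_limit.
Qed.

Lemma F2_fixed_le V1 V2 : Uplus omega V1 -> Uplus omega V2 -> T V1 = V1 -> T V2 = V2 ->
  forall s, V1 s <= V2 s.
Proof.
move=> U1 U2 T1 T2; have [L L0 V1L] := Uplus_bounded U1.
apply: (@le_of_contracted_shift _ _ omega delta L) => //.
- by case: U2.
- by move=> s; case/andP: (V1L s).
by move=> t t0 V12 s; rewrite -T1 -T2; exact: F2_le_shift.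
Qed.

Lemma F2_fixed_unique V : Uplus omega V -> T V = V -> V = wstar.
Proof.
move=> UV TV; apply/funext => s; apply/eqP; rewrite eq_le.
by rewrite !F2_fixed_le//; [exact: F2_limit_Uplus|exact: F2_limit_fixed|
  exact: F2_limit_Uplus|exact: F2_limit_fixed].
Qed.

(** Comparison of a solution [V1] with a supersolution [V2] along one policy, where the objective
    contracts without any maximisation. It serves both optimality and uniqueness of the value
    function. *)
Lemma policy_value_le (f : S -> A) V1 V2 : (forall s, K (s, f s)) ->
  Bplus omega V1 -> Bplus omega V2 ->
  (forall s, V1 s = Q V1 (s, f s)) -> (forall s, Q V2 (s, f s) <= V2 s) ->
  forall s, V1 s <= V2 s.
Proof.
move=> Kf B1 B2 V1E V2E.
have [L1 L10 V1L] := Bplus_bounded B1; have [L2 L20 V2L] := Bplus_bounded B2.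
case: (B1) (B2) => V10 mV1 _ [V20 mV2 _].
apply: (@le_of_contracted_shift _ _ omega delta L1) => //.
  by move=> s; case/andP: (V1L s).
move=> t t0 V12 s; rewrite V1E.
apply: (@le_trans _ _ (Q V2 (s, f s) + delta * t * omega s)); last by rewrite lerD2r.
exact: (@F2_objective_le_shift V1 V2 L2 t (s, f s)).
Qed.

End dynamic_program.

(** * The aggregator *)

Lemma powR_invK (R : realType) (x p : R) : 0 <= x -> p != 0 -> (x `^ p^-1) `^ p = x.
Proof. by move=> x0 p0; rewrite -powRrM mulVf// powRr1. Qed.

Lemma powRK (R : realType) (x p : R) : 0 <= x -> p != 0 -> (x `^ p) `^ p^-1 = x.
Proof. by move=> x0 p0; rewrite -powRrM mulfV// powRr1. Qed.

Section aggregator.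
Context {R : realType} {S A : ptopologicalType}.
Context (q : S * A -> probability (borel S) R) (u : S * A -> R).
Context (beta gamma rho theta : R).
Hypothesis beta_ge0 : 0 <= beta.
Hypothesis beta_lt1 : beta < 1.
Hypothesis rho_lt1 : rho < 1.
Hypothesis thetaE : theta = (1 - gamma) / (1 - rho).
Implicit Types v : S -> R.

Let rho_gt0 : 0 < 1 - rho. Proof. by rewrite subr_gt0. Qed.
Let rho_neq0 : 1 - rho != 0. Proof. by rewrite gt_eqF. Qed.

(** The exponents agree because [(1 - rho) * theta = 1 - gamma]. *)
Lemma aggregatorE k v :
  aggregator beta gamma rho u q k v =
  F2_objective beta rho theta u q (fun s => v s `^ (1 - rho)) k `^ (1 - rho)^-1.
Proof.
have E : \int[q k]_s (v s `^ (1 - gamma)) = \int[q k]_s ((v s `^ (1 - rho)) `^ theta).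
  by apply: eq_Rintegral => s _; rewrite -powRrM thetaE mulrC divfK.
by rewrite /aggregator /F2_objective E thetaE invf_div.
Qed.

Lemma aggregator_powR k v :
  aggregator beta gamma rho u q k v `^ (1 - rho) =
  F2_objective beta rho theta u q (fun s => v s `^ (1 - rho)) k.
Proof. by rewrite aggregatorE powR_invK// F2_objective_ge0. Qed.

(** Increasing power maps carry maxima to maxima, in both directions. *)
Lemma bellman_is_max (K : set (S * A)) v : (forall s, 0 <= v s) ->
  bellman beta gamma rho K u q v <->
  forall s, is_max [set F2_objective beta rho theta u q (fun s => v s `^ (1 - rho)) (s, a)
                   | a in actions K s] (v s `^ (1 - rho)).
Proof.
move=> v0; split=> [bv s|mv s].
  rewrite (_ : [set _ | _ in _] =
    [set x `^ (1 - rho) | x in [set aggregator beta gamma rho u q (s, a) v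
                               | a in actions K s]]).
    apply: is_max_image_powR => //.
    by move=> _ [a Ka <-]; exact: powR_ge0.
  by rewrite image_comp; apply: eq_imagel => a Ka /=; rewrite aggregator_powR.
rewrite (_ : v s = (v s `^ (1 - rho)) `^ (1 - rho)^-1); last by rewrite powRK.
rewrite (_ : [set _ | _ in _] = [set x `^ (1 - rho)^-1 | x in
    [set F2_objective beta rho theta u q (fun s => v s `^ (1 - rho)) (s, a)
    | a in actions K s]]).
  apply: is_max_image_powR => //; first by rewrite invr_gt0.
  by move=> _ [a Ka <-]; exact: F2_objective_ge0.
by rewrite image_comp; apply: eq_imagel => a Ka /=; rewrite aggregatorE.
Qed.

End aggregator.

(** * Derivation of claims (a) to (d) from the fixed point *)

Unset Implicit Arguments.

Theorem theorem2 (R : realType) (S A : ptopologicalType)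
    (borelS : borel_space R S) (borelA : borel_space R A)
    (K : set (S * A))
    (K_neq0 : K !=set0)
    (mK : measurable (K : set (borel (S * A)%type)))
    (A_neq0 : forall s, actions K s !=set0)
    (q : S * A -> probability (borel S) R)
    (q_trans : transition_probability K q)
    (q_feller : feller K q)
    (u : S * A -> R)
    (u_ge0 : forall k, K k -> 0 <= u k)
    (u_usc : upper_semicontinuous (u : subspace K -> R))
    (beta gamma rho theta : R)
    (beta_ge0 : 0 <= beta) (beta_lt1 : beta < 1)
    (gamma_gt0 : 0 < gamma) (gamma_lt_rho : gamma < rho) (rho_lt1 : rho < 1)
    (thetaE : theta = (1 - gamma) / (1 - rho))
    (omega : S -> R)
    (omega_ge1 : forall s, 1 <= omega s) (omega_cont : continuous omega)
    (M c : R) (M_gt0 : 0 < M) (c_ge1 : 1 <= c)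
    (A_compact : forall s, compact (actions K s))
    (A_usc : usc_correspondence (actions K))
    (r_le : forall k, K k -> reward beta rho u k <= M * omega k.1)
    (omega_int_cont :
      {within K, continuous (fun k => (\int[q k]_s (omega s `^ theta)%:E)%E)})
    (omega_int_le : forall k, K k ->
      (\int[q k]_s (omega s `^ theta)%:E <= (c * omega k.1 `^ theta)%:E)%E)
    (c_beta : c `^ theta^-1 * beta < 1) :
  let T := F2 beta rho theta K u q in
  exists wstar : S -> R,
    let vstar := fun s => wstar s `^ (1 - rho)^-1 in
    [/\ (* (a) *)
        [/\ (forall V, Uplus omega V -> forall s,
               is_max [set F2_objective beta rho theta u q V (s, a)
                      | a in actions K s] (T V s)),
            contraction_on (Uplus omega)
              (fun V1 V2 => wnorm omega (fun s => V1 s - V2 s))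
              (c `^ theta^-1 * beta) T,
            Uplus omega wstar /\ T wstar = wstar,
            (forall w, Uplus omega w -> T w = w -> w = wstar) &
            (forall n : nat,
               (wnorm omega (fun s => iter n T (fun=> 0) s - wstar s)%R <=
                (c `^ (n%:R / theta) * beta ^+ n
                   / (1 - c `^ theta^-1 * beta) * M)%:E)%E)],
        (* (b) *)
        [/\ forall s, 0 <= vstar s,
            Uplus omega (fun s => vstar s `^ (1 - rho)),
            bellman beta gamma rho K u q vstar &
            forall v : S -> R,
              (forall s, 0 <= v s) -> Uplus omega (fun s => v s `^ (1 - rho)) ->
              bellman beta gamma rho K u q v -> v = vstar],
        (* (c) *)
        exists2 f : S -> A, policy K f &
          forall s, vstar s = aggregator beta gamma rho u q (s, f s) vstar &
        (* (d) *)
        forall f : S -> A, policy K f ->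
          (forall s, vstar s = aggregator beta gamma rho u q (s, f s) vstar) ->
          optimal beta gamma rho omega K u q vstar f].
Proof.
set delta := c `^ theta^-1 * beta.
move=> T; have rho_gt0 : 0 < 1 - rho by rewrite subr_gt0.
have rho_neq0 : 1 - rho != 0 by rewrite gt_eqF.
have theta_ge1 : 1 <= theta.
  by rewrite thetaE ler_pdivlMr// mul1r lerD2l lerN2 ltW.
have delta_ge0 : 0 <= delta by rewrite mulr_ge0// powR_ge0.
have F2max := F2_is_max borelS A_neq0 q_feller u_ge0 u_usc beta_ge0 beta_lt1
  rho_lt1 theta_ge1 omega_ge1 omega_cont A_compact omega_int_cont omega_int_le.
have F2contr := F2_contraction borelS A_neq0 q_feller u_ge0 u_usc beta_ge0
  beta_lt1 rho_lt1 theta_ge1 omega_ge1 omega_cont c_ge1 A_compact A_usc r_le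
  omega_int_cont omega_int_le.
have Uw := F2_limit_Uplus borelS A_neq0 q_feller u_ge0 u_usc beta_ge0 beta_lt1
  rho_lt1 theta_ge1 omega_ge1 omega_cont M_gt0 c_ge1 A_compact A_usc r_le
  omega_int_cont omega_int_le c_beta.
have Tw := F2_limit_fixed borelS A_neq0 q_feller u_ge0 u_usc beta_ge0 beta_lt1
  rho_lt1 theta_ge1 omega_ge1 omega_cont M_gt0 c_ge1 A_compact A_usc r_le
  omega_int_cont omega_int_le c_beta.
have w_uniq := F2_fixed_unique borelS A_neq0 q_feller u_ge0 u_usc beta_ge0 beta_lt1
  rho_lt1 theta_ge1 omega_ge1 omega_cont M_gt0 c_ge1 A_compact A_usc r_le
  omega_int_cont omega_int_le c_beta.
have iter_le_w := F2_iter_le_limit borelS A_neq0 q_feller u_ge0 u_usc beta_ge0 beta_lt1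
  rho_lt1 theta_ge1 omega_ge1 omega_cont M_gt0 c_ge1 A_compact A_usc r_le
  omega_int_cont omega_int_le c_beta.
have w_le_iter := F2_limit_le_iter borelS A_neq0 q_feller u_ge0 u_usc beta_ge0 beta_lt1
  rho_lt1 theta_ge1 omega_ge1 omega_cont M_gt0 c_ge1 A_compact A_usc r_le
  omega_int_cont omega_int_le c_beta.
have Q_usc := F2_objective_usc borelS q_feller u_ge0 u_usc beta_ge0 beta_lt1
  rho_lt1 theta_ge1 omega_ge1 omega_cont omega_int_cont omega_int_le.
have value_le := policy_value_le beta_ge0 theta_ge1 omega_ge1 omega_cont c_ge1
  omega_int_le c_beta.
(* From here on the limit enters only through these five properties. *)
move: Uw Tw w_uniq iter_le_w w_le_iter.
move: (F2_limit K q u beta rho theta) => w Uw Tw w_uniq iter_le_w w_le_iter.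
have w_ge0 s : 0 <= w s by case: Uw.
have wmax s : is_max [set F2_objective beta rho theta u q w (s, a) | a in actions K s] (w s).
  by rewrite -{2}Tw; exact: F2max.
exists w => vstar.
have vstar_ge0 s : 0 <= vstar s by exact: powR_ge0.
have vstarKs s : vstar s `^ (1 - rho) = w s by exact: powR_invK.
have vstarK : (fun s => vstar s `^ (1 - rho)) = w by exact/funext.
have vstarD s : vstar s = w s `^ (1 - rho)^-1 by [].
have aggE := aggregatorE q u beta rho_lt1 thetaE.
have aggK := aggregator_powR q u beta_ge0 beta_lt1 rho_lt1 thetaE.
have bellE := bellman_is_max q u beta_ge0 beta_lt1 rho_lt1 thetaE K.
clearbody vstar.
have vstarE f : (forall s, vstar s = aggregator beta gamma rho u q (s, f s) vstar) ->
    forall s, w s = F2_objective beta rho theta u q w (s, f s).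
  by move=> fE s; rewrite -vstarKs fE aggK vstarK.
have valueE f v : value_function beta gamma rho omega u q f v ->
    Bplus omega (fun s => v s `^ (1 - rho)) /\ forall s, v s `^ (1 - rho) =
      F2_objective beta rho theta u q (fun s => v s `^ (1 - rho)) (s, f s).
  by move=> [v0 Bv vE]; split => // s; rewrite {1}vE aggK.
have Bw := Uplus_Bplus Uw.
split.
- split.
  + by move=> V UV s; exact: F2max.
  + exact: F2contr.
  + by [].
  + exact: w_uniq.
  + move=> n; apply/(wnorm_leP omega_ge1) => s.
    have -> : c `^ (n%:R / theta) * beta ^+ n = delta ^+ n.
      by rewrite /delta exprMn -(powR_mulrn n (powR_ge0 _ _)) -powRrM (mulrC _ n%:R).
    rewrite distrC ger0_norm ?subr_ge0; last exact: iter_le_w.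
    rewrite lerBlDl -[X in X * omega s]mulrA (mulrC _ M).
    exact: w_le_iter.
- split => //.
  + by rewrite vstarK.
  + apply/(bellE _ vstar_ge0) => s.
    by rewrite vstarK vstarKs.
  + move=> v v0 Uv /(bellE _ v0) mv.
    (* A Bellman solution becomes a fixed point of [F2] after the change of variable. *)
    have vw : (fun s => v s `^ (1 - rho)) = w.
      apply: w_uniq => //.
      by apply/funext => s; rewrite /F2; apply: is_max_sup; apply: mv.
    by apply/funext => s; rewrite vstarD -vw powRK.
- have [f pf fw] := argmax_selection borelA A_compact A_usc (Q_usc _ Uw) wmax.
  exists f => // s.
  by rewrite aggE vstarK fw.
move=> f pf fE; have [mf Kf] := pf.
have wE := vstarE f fE.
split => //.
- by split => //; rewrite vstarK.
- move=> v vv; have [v0 _ _] := vv; have [Bv vE] := valueE _ _ vv.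
  apply/funext => s; rewrite -(powRK (v0 s) rho_neq0) vstarD; congr (_ `^ _).
  (* Both functions solve the same equation along [f], so the comparison applies in either
     direction. *)
  apply/eqP; rewrite eq_le; apply/andP; split.
    by apply: (value_le _ _ f _ _ Kf Bv Bw vE) => s'; rewrite -wE.
  by apply: (value_le _ _ f _ _ Kf Bw Bv wE) => s'; rewrite -vE.
move=> g v [mg Kg] vv s; have [v0 _ _] := vv; have [Bv vE] := valueE _ _ vv.
rewrite -(powRK (v0 s) rho_neq0) vstarD ge0_ler_powR ?nnegrE ?powR_ge0//.
  by rewrite invr_ge0 ltW.
(* The maximum property makes [w] a supersolution along [g]. *)
apply: (value_le _ _ g _ _ Kg Bv Bw vE) => s'.
by have [_] := wmax s'; apply; exists (g s').
Qed.
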